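(* (Completeness.) For every set of formulas $\Phi\cup\{\varphi\}$ of the logic $\mathit{S5BKE}$: if $\Phi\Vdash\varphi$, then $\Phi\vdash\varphi$.
   Context: Language: formulas $Fm$ are built from propositional variables $V=\{x_0,x_1,\dots\}$ with $\neg,\rightarrow$ and unary operators $\square$ (evidence), $K$ (knowledge), $B$ (belief); $\wedge,\vee,\leftrightarrow,\top,\bot$ are the usual classical abbreviations. Axioms of $\mathit{S5BKE}$ (all instances of): (i) every formula having the form of a classical propositional tautology; (ii) $K\varphi\rightarrow\varphi$; (iii) $K\varphi\rightarrow B\varphi$; (iv) $\square\varphi\rightarrow\square\square\varphi$; (v) $\neg\square\varphi\rightarrow\square\neg\square\varphi$; (vi) $\square\varphi\rightarrow K\varphi$; (vii) $K(\varphi\rightarrow\psi)\rightarrow(K\varphi\rightarrow K\psi)$; (viii) $B(\varphi\rightarrow\psi)\rightarrow(B\varphi\rightarrow B\psi)$; (ix) $\square(\varphi\rightarrow\psi)\rightarrow(\square\varphi\rightarrow\square\psi)$; (x) $\neg B\bot$. Rules: modus ponens, and axiom necessitation (if $\varphi$ is an axiom, infer $\square\varphi$). $\Phi\vdash\varphi$ means there is a finite sequence ending in $\varphi$ each member of which is in $\Phi$, an axiom, obtained by modus ponens from earlier members, or is $\square\psi$ for an earlier member $\psi$ that is an axiom. Algebraic semantics: a model is $\mathcal{M}=(M,\mathit{TRUE},\vee,\wedge,\neg,0,1,\square,B,K)$ where $(M,\vee,\wedge,\neg,0,1)$ is a Boolean algebra, $\mathit{TRUE}$ is an ultrafilter,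 and $\square,B,K:M\to M$ satisfy: (1) $\square a=1$ if $a=1$ and $\square a=0$ otherwise; (2) for every ultrafilter $U$, the sets $\mathit{KNOW}(U)=\{a\in M: Ka\in U\}$ and $\mathit{BEL}(U)=\{a\in M: Ba\in U\}$ are proper filters with $\mathit{KNOW}(U)\subseteq U\cap\mathit{BEL}(U)$. An assignment $\gamma:V\to M$ extends homomorphically to $Fm$ ($\neg,\rightarrow$ interpreted by Boolean complement and $a\rightarrow b=\neg a\vee b$, and $\square,K,B$ by the corresponding operations). $(\mathcal{M},\gamma)\vDash\varphi$ iff $\gamma(\varphi)\in\mathit{TRUE}$. $\Phi\Vdash\varphi$ iff every interpretation $(\mathcal{M},\gamma)$ satisfying all formulas of $\Phi$ satisfies $\varphi$. *)

(* Defs.v *)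
From mathcomp Require Import all_boot all_order.
From mathcomp Require Import boolp classical_sets.

Set Implicit Arguments.
Unset Strict Implicit.
Unset Printing Implicit Defensive.

Import Order.Theory.

Inductive form : Type :=
| Var of nat
| Neg of form
| Imp of form & form
| Box of form
| Know of form
| Bel of form.

Definition Top : form := Imp (Var 0) (Var 0).
Definition Bot : form := Neg Top.

Inductive pform : Type :=
| PVar of nat
| PNeg of pform
| PImp of pform & pform.

Fixpoint peval (v : nat -> bool) (p : pform) : bool :=
  match p with
  | PVar n => v n
  | PNeg p => ~~ peval v p
  | PImp p q => peval v p ==> peval v q
  end.

Definition tautology (p : pform) : Prop := forall v, peval v p.

Fixpoint psubst (s : nat -> form) (p : pform) : form :=
  match p with
  | PVar n => s n
  | PNeg p => Neg (psubst s p)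
  | PImp p q => Imp (psubst s p) (psubst s q)
  end.

Inductive S5BKE_axiom : form -> Prop :=
| ax_taut p s : tautology p -> S5BKE_axiom (psubst s p)
| ax_KT f : S5BKE_axiom (Imp (Know f) f)
| ax_KB f : S5BKE_axiom (Imp (Know f) (Bel f))
| ax_box4 f : S5BKE_axiom (Imp (Box f) (Box (Box f)))
| ax_box5 f : S5BKE_axiom (Imp (Neg (Box f)) (Box (Neg (Box f))))
| ax_boxK f : S5BKE_axiom (Imp (Box f) (Know f))
| ax_distK f g :
    S5BKE_axiom (Imp (Know (Imp f g)) (Imp (Know f) (Know g)))
| ax_distB f g :
    S5BKE_axiom (Imp (Bel (Imp f g)) (Imp (Bel f) (Bel g)))
| ax_distbox f g :
    S5BKE_axiom (Imp (Box (Imp f g)) (Imp (Box f) (Box g)))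
| ax_consB : S5BKE_axiom (Neg (Bel Bot)).

Definition derivation (Phi : set form) (s : seq form) : Prop :=
  forall i, i < size s ->
  let f := nth Bot s in
  [\/ Phi (f i),
      S5BKE_axiom (f i),
      exists j k, [/\ j < i, k < i & f k = Imp (f j) (f i)] |
      exists2 j, j < i & S5BKE_axiom (f j) /\ f i = Box (f j)].

Definition derives (Phi : set form) (phi : form) : Prop :=
  exists s, derivation Phi (rcons s phi).

Section Filters.
Local Open Scope order_scope.
Variables (disp : Order.disp_t) (M : ctbDistrLatticeType disp).

Definition lfilter (F : set M) : Prop :=
  [/\ F \top,
      forall a b, F a -> F b -> F (a `&` b) &
      forall a b, a <= b -> F a -> F b].

Definition proper_lfilter (F : set M) : Prop := lfilter F /\ ~ F \bot.

Definition ultra_lfilter (U : set M) : Prop :=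
  proper_lfilter U /\
  forall F : set M, proper_lfilter F -> (U `<=` F)%classic -> F = U.

End Filters.

(* Boolean algebras are MathComp's [ctbDistrLatticeType]s (complemented
   bounded distributive lattices).  They may be degenerate, but the existence
   of the ultrafilter [TRUE] forces \bot and \top to differ in a model. *)
Record model : Type := Model {
  disp : Order.disp_t;
  carrier :> ctbDistrLatticeType disp;
  TRUE : set carrier;
  box : carrier -> carrier;
  bel : carrier -> carrier;
  know : carrier -> carrier;
  TRUE_ultra : ultra_lfilter TRUE;
  boxE : forall a : carrier,
    box a = if a == \top%O then \top%O else \bot%O;
  know_proper : forall U : set carrier, ultra_lfilter U ->
    proper_lfilter [set a | U (know a)]%classic;
  bel_proper : forall U : set carrier, ultra_lfilter U ->
    proper_lfilter [set a | U (bel a)]%classic;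
  know_sub : forall U : set carrier, ultra_lfilter U ->
    ([set a | U (know a)] `<=` U `&` [set a | U (bel a)])%classic
}.

Fixpoint interp (M : model) (g : nat -> M) (f : form) : M :=
  match f with
  | Var n => g n
  | Neg f => (~` interp g f)%O
  | Imp f h => (~` interp g f `|` interp g h)%O
  | Box f => box (interp g f)
  | Know f => know (interp g f)
  | Bel f => bel (interp g f)
  end.

Definition satisfies (M : model) (g : nat -> M) (f : form) : Prop :=
  @TRUE M (interp g f).

Definition entails (Phi : set form) (phi : form) : Prop :=
  forall (M : model) (g : nat -> M),
    (forall psi, Phi psi -> satisfies g psi) -> satisfies g phi.

(* Main.v *)
Require Import Defs.
From mathcomp Require Import all_boot all_order.
From mathcomp Require Import boolp classical_sets.

(** Canonical Kripke model.  If [phi] is not derivable from [Phi], extend the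
    deductive closure of [Phi] to a maximal theory [G] omitting [phi].  The
    worlds are the maximal theories [w] containing every [f] with [Box f] in
    [G], and the algebra is the full powerset of worlds, with [TRUE] the
    principal ultrafilter at [G].  Axioms 4 and 5 make the membership of
    [Box f] the same at all worlds, so that [Box f] is interpreted by the
    whole space or by the empty set; [Know] and [Bel] are the necessity
    operators of the canonical accessibility relations.  Such operators are
    multiplicative, so the filter conditions hold at every ultrafilter of the
    powerset, not only at the principal ones. *)

Set Implicit Arguments.
Unset Strict Implicit.
Unset Printing Implicit Defensive.

Import Order.Theory.
Local Open Scope classical_set_scope.

(** * Theories *)

(** Derivability from no premises, given inductively so that closure properties of the calculus can
    be proved by induction. *)
Inductive thm : form -> Prop :=
| thm_ax f : S5BKE_axiom f -> thm f
| thm_nec f : S5BKE_axiom f -> thm (Box f)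
| thm_mp f g : thm (Imp f g) -> thm f -> thm g.

(** Axiom necessitation needs no clause of its own: boxed axioms are already theorems. *)
Definition theory (X : set form) : Prop :=
  (forall f, thm f -> X f) /\ (forall f g, X (Imp f g) -> X f -> X g).

Definition maximal_theory (T : set form) : Prop :=
  theory T /\ forall f, T (Neg f) <-> ~ T f.

(** Necessitation, a rule for axioms only, is admissible for all theorems: axiom 4 handles boxed
    axioms, and distribution of [Box] handles modus ponens. *)
Lemma thm_box f : thm f -> thm (Box f).
Proof.
elim=> {f} [f fax|f fax|f g _ Bfg _ Bf].
- exact: thm_nec.
- by apply: (thm_mp (thm_ax (ax_box4 f))); apply: thm_nec.
- by apply: (thm_mp _ Bf); apply: (thm_mp _ Bfg); apply/thm_ax/ax_distbox.
Qed.

Definition assign3 (f g h : form) (n : nat) : form :=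
  if n is n.+1 then (if n is n.+1 then h else g) else f.

Lemma thm_taut3 p f g h : tautology p -> thm (psubst (assign3 f g h) p).
Proof. by move=> tp; apply/thm_ax/ax_taut. Qed.

Lemma thm_imp_refl f : thm (Imp f f).
Proof.
apply: (@thm_taut3 (PImp (PVar 0) (PVar 0)) f f f) => v /=.
by case: (v 0).
Qed.

Lemma thm_weaken f g : thm (Imp f (Imp g f)).
Proof.
apply: (@thm_taut3 (PImp (PVar 0) (PImp (PVar 1) (PVar 0))) f g f) => v /=.
by case: (v 0); case: (v 1).
Qed.

Lemma thm_imp_dist f g h :
  thm (Imp (Imp f (Imp g h)) (Imp (Imp f g) (Imp f h))).
Proof.
apply: (@thm_taut3 (PImp (PImp (PVar 0) (PImp (PVar 1) (PVar 2)))
  (PImp (PImp (PVar 0) (PVar 1)) (PImp (PVar 0) (PVar 2)))) f g h) => v /=.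
by case: (v 0); case: (v 1); case: (v 2).
Qed.

Lemma thm_explosion f g : thm (Imp (Neg f) (Imp f g)).
Proof.
apply: (@thm_taut3 (PImp (PNeg (PVar 0)) (PImp (PVar 0) (PVar 1))) f g f) => v.
by rewrite /=; case: (v 0); case: (v 1).
Qed.

Lemma thm_cases f g : thm (Imp (Imp f g) (Imp (Imp (Neg f) g) g)).
Proof.
apply: (@thm_taut3 (PImp (PImp (PVar 0) (PVar 1))
  (PImp (PImp (PNeg (PVar 0)) (PVar 1)) (PVar 1))) f g f) => v /=.
by case: (v 0); case: (v 1).
Qed.

Lemma theory_thm_mp X f g : theory X -> thm (Imp f g) -> X f -> X g.
Proof. by move=> [thmX mpX] fg; apply/mpX/thmX. Qed.

(** The deduction theorem in disguise: this set is the theory generated by [X] and [g]. *)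
Lemma theory_imp X g : theory X -> theory [set h | X (Imp g h)].
Proof.
move=> [thmX mpX]; split=> [f tf|f h Xgfh Xgf] /=.
  by apply/thmX/(thm_mp _ tf)/thm_weaken.
by apply: (mpX _ _ _ Xgf); apply: (mpX _ _ _ Xgfh); apply/thmX/thm_imp_dist.
Qed.

Lemma thm_imp_trans f g h :
  thm (Imp f g) -> thm (Imp g h) -> thm (Imp f h).
Proof.
move=> fg gh; have th_imp : theory [set k | thm (Imp f k)].
  by apply: theory_imp; split=> // k l; apply: thm_mp.
exact: (theory_thm_mp th_imp gh fg).
Qed.

Lemma thm_box_elim f : thm (Imp (Box f) f).
Proof. exact: (thm_imp_trans (thm_ax (ax_boxK f)) (thm_ax (ax_KT f))). Qed.

Lemma thm_box_bel f : thm (Imp (Box f) (Bel f)).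
Proof. exact: (thm_imp_trans (thm_ax (ax_boxK f)) (thm_ax (ax_KB f))). Qed.

(** A distributive operator implied by [Box] inherits necessitation from [thm_box], so it behaves as
    a normal modality. *)
Lemma theory_modality (O : form -> form) X :
    (forall f g, thm (Imp (O (Imp f g)) (Imp (O f) (O g)))) ->
    (forall f, thm (Imp (Box f) (O f))) ->
  theory X -> theory [set f | X (O f)].
Proof.
move=> distO boxO thX; split=> [f tf|f g XOfg XOf] /=.
  by apply/(theory_thm_mp thX (boxO f))/thX.1/thm_box.
exact: (thX.2 _ _ (theory_thm_mp thX (distO f g) XOfg) XOf).
Qed.

Lemma theory_box X : theory X -> theory [set f | X (Box f)].
Proof.
apply: theory_modality => [f g|f]; last exact: thm_imp_refl.
exact/thm_ax/ax_distbox.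
Qed.

Lemma theory_know X : theory X -> theory [set f | X (Know f)].
Proof.
apply: theory_modality => [f g|f]; apply: thm_ax.
- exact: ax_distK.
- exact: ax_boxK.
Qed.

Lemma theory_bel X : theory X -> theory [set f | X (Bel f)].
Proof.
apply: theory_modality => [f g|f]; last exact: thm_box_bel.
exact/thm_ax/ax_distB.
Qed.

Lemma theory_chain_union (F : set (set form)) X0 : F X0 ->
    total_on F (fun X Y => X `<=` Y) -> (forall X, F X -> theory X) ->
  theory (\bigcup_(X in F) X).
Proof.
move=> FX0 totF thF; split=> [f tf|f g [X FX Xfg] [Y FY Yf]].
  by exists X0 => //; apply: (thF _ FX0).1.
have [XY|YX] := totF X Y FX FY.
  by exists Y => //; apply: (thF Y FY).2 Yf; apply: XY.
by exists X => //; apply: (thF X FX).2 Xfg _; apply: YX.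
Qed.

Lemma lindenbaum X f : theory X -> ~ X f ->
  exists T, [/\ maximal_theory T, X `<=` T & ~ T f].
Proof.
move=> thX nXf.
(* The empty set is admitted only because the empty chain needs a union. *)
pose P A := A = set0 \/ [/\ theory A, X `<=` A & ~ A f].
have [|A [PA maxA]] := @Zorn_bigcup _ P.
  move=> F FP totF.
  have [[X0 [FX0 X0n0]]|allF0] := pselect (exists X0, F X0 /\ X0 <> set0).
    right; pose F' := [set Y | F Y /\ Y <> set0].
    have -> : \bigcup_(Y in F) Y = \bigcup_(Y in F') Y.
      apply/seteqP; split=> h [Y FY Yh]; exists Y => //; last by case: FY.
      by split=> // Y0; rewrite Y0 in Yh.
    have F'P Y : F' Y -> [/\ theory Y, X `<=` Y & ~ Y f].
      by move=> [FY Yn0]; case: (FP Y FY).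
    split.
    - apply: (@theory_chain_union _ X0) => // [Y Z [FY _] [FZ _]|Y /F'P[]//].
      exact: totF.
    - have [_ XX0 _] := F'P X0 (conj FX0 X0n0).
      by move=> h /XX0 X0h; exists X0.
    - by move=> [Y /F'P[_ _ nYf]].
  left; apply/seteqP; split=> // h [Y FY Yh].
  by case: allF0; exists Y; split=> // Y0; rewrite Y0 in Yh.
have {PA} [thA XA nAf] : [/\ theory A, X `<=` A & ~ A f].
  (* The empty set is not maximal: [X] contains a theorem and so lies strictly above it. *)
  case: PA => // A0; exfalso; apply: (maxA X); last by right; split.
  rewrite A0; split=> // X0.
  exact: (X0 _ (thX.1 _ (thm_imp_refl f))).
(* By maximality the theory generated by [A] and [g] proves [f]. *)
have step g : ~ A g -> A (Imp g f).
  move=> nAg; apply: contrapT => nAgf.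
  apply: (maxA [set h | A (Imp g h)]).
    split=> [h Ah|sub]; first exact: (theory_thm_mp thA (thm_weaken _ _)).
    by apply/nAg/sub/thA.1/thm_imp_refl.
  right; split=> //; first exact: theory_imp.
  by move=> h /XA Ah; exact: (theory_thm_mp thA (thm_weaken _ _)).
exists A; split=> //; split=> // g; split=> [ANg Ag|nAg].
  apply: nAf; apply: (thA.2 _ _ _ Ag).
  exact: (theory_thm_mp thA (thm_explosion _ _)).
(* If [g] and [Neg g] were both missing, each would imply [f] in [A], and a case split would put [f]
   in [A]. *)
apply: contrapT => /step ANgf; apply: nAf; apply: (thA.2 _ _ _ ANgf).
exact: (theory_thm_mp thA (thm_cases _ _) (step _ nAg)).
Qed.

Lemma maximal_theory_imp T f g : maximal_theory T ->
  T (Imp f g) <-> ~ T f \/ T g.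
Proof.
move=> [thT negT]; split=> [Tfg|[/negT TNf|Tg]].
- by have [Tf|] := pselect (T f); [right; apply: thT.2 Tfg Tf|left].
- exact: (theory_thm_mp thT (thm_explosion _ _)).
- exact: (theory_thm_mp thT (thm_weaken _ _)).
Qed.

(** * Derivations *)

Lemma derivation_cat Phi s t :
  derivation Phi s -> derivation Phi t -> derivation Phi (s ++ t).
Proof.
move=> ds dt i; rewrite size_cat /= => ilt.
have [si|si] := ltnP i (size s).
  rewrite nth_cat si; case: (ds i si) => [H|H|[j [k [ji ki e]]]|[j ji [Hj e]]].
  - by constructor 1.
  - by constructor 2.
  - by constructor 3; exists j, k; rewrite !nth_cat !(ltn_trans _ si).
  - by constructor 4; exists j => //; rewrite !nth_cat !(ltn_trans _ si).
have nthR j : nth Bot (s ++ t) (size s + j) = nth Bot t j.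
  by rewrite nth_cat ltnNge leq_addr /= addKn.
rewrite -(subnKC si) in ilt *; rewrite ltn_add2l in ilt.
set m := i - size s in ilt *.
rewrite nthR; case: (dt m ilt) => [H|H|[j [k [ji ki e]]]|[j ji [Hj e]]].
- by constructor 1.
- by constructor 2.
- by constructor 3; exists (size s + j), (size s + k); rewrite !ltn_add2l !nthR.
- by constructor 4; exists (size s + j); rewrite ?ltn_add2l ?nthR.
Qed.

Lemma derivation_rcons Phi s f : derivation Phi s ->
    [\/ Phi f,
        S5BKE_axiom f,
        exists j k, [/\ j < size s, k < size s &
                     nth Bot s k = Imp (nth Bot s j) f] |
        exists2 j, j < size s &
          S5BKE_axiom (nth Bot s j) /\ f = Box (nth Bot s j)] ->
  derivation Phi (rcons s f).
Proof.
move=> ds lastf i; rewrite size_rcons ltnS leq_eqVlt /=.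
case/predU1P=> [->|si].
  rewrite nth_rcons ltnn eqxx.
  case: lastf => [H|H|[j [k [js ks e]]]|[j js [Hj e]]].
  - by constructor 1.
  - by constructor 2.
  - by constructor 3; exists j, k; rewrite !nth_rcons js ks.
  - by constructor 4; exists j => //; rewrite nth_rcons js.
rewrite nth_rcons si; case: (ds i si) => [H|H|[j [k [ji ki e]]]|[j ji [Hj e]]].
- by constructor 1.
- by constructor 2.
- by constructor 3; exists j, k; rewrite !nth_rcons !(ltn_trans _ si).
- by constructor 4; exists j => //; rewrite !nth_rcons !(ltn_trans _ si).
Qed.

Lemma derivation_nil Phi : derivation Phi [::].
Proof. by []. Qed.

Lemma derives_hyp (Phi : set form) f : Phi f -> derives Phi f.
Proof.
by exists [::]; apply: derivation_rcons; [apply: derivation_nil|constructor 1].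
Qed.

Lemma derives_mp Phi f g :
  derives Phi (Imp f g) -> derives Phi f -> derives Phi g.
Proof.
move=> [s ds] [t dt]; exists (rcons s (Imp f g) ++ rcons t f).
apply: derivation_rcons; first exact: derivation_cat.
(* The implication ends the first block, at index [size s]; [f] ends the second, which is shifted by
   the first block's length [(size s).+1]. *)
constructor 3; exists ((size s).+1 + size t), (size s).
rewrite size_cat !size_rcons ltn_add2l ltnSn leq_addr; split=> //.
rewrite !nth_cat !size_rcons ltnSn ltnNge leq_addr /= addKn.
by rewrite !nth_rcons !ltnn !eqxx.
Qed.

Lemma derives_thm Phi f : thm f -> derives Phi f.
Proof.
elim=> {f} [f fax|f fax|f g _ + _]; last exact: derives_mp.
  by exists [::]; apply: derivation_rcons; [apply: derivation_nil|constructor 2].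
exists [:: f]; apply: derivation_rcons; last by constructor 4; exists 0.
by apply: (@derivation_rcons _ [::]); [apply: derivation_nil|constructor 2].
Qed.

Lemma theory_derives Phi : theory (derives Phi).
Proof. by split=> [f|f g]; [apply: derives_thm|apply: derives_mp]. Qed.

(** * Powerset models of Kripke frames *)

Definition nec (W : Type) (R : W -> W -> Prop) (a : set W) : set W :=
  [set w | forall v, R w v -> a v].

(** [nec R] preserves the top, meets and order, so it pulls filters back to filters; seriality sends
    the empty set to itself, which keeps them proper. *)
Lemma proper_lfilter_nec W (R : W -> W -> Prop) (U : set (set W)) :
  (forall w, exists v, R w v) -> proper_lfilter U ->
  proper_lfilter [set a | U (nec R a)].
Proof.
move=> serial [[UT UI UU] Ubot]; split; last first.
  rewrite /= (_ : nec R _ = set0) //; apply/seteqP; split=> // w Rw.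
  by have [v /Rw] := serial w.
split=> [|a b Ua Ub|a b /subsetPset ab] /=.
- by rewrite (_ : nec R _ = setT) //; apply/seteqP; split.
- rewrite (_ : nec R _ = nec R a `&` nec R b); first exact: UI.
  apply/seteqP; split=> [w Rw|w [Ra Rb] v Rwv].
    by split=> v /Rw[].
  by split; [apply: Ra|apply: Rb].
- by apply: UU; apply/subsetPset => w Ra v /Ra/ab.
Qed.

(** A larger filter would contain some [a] missing [w] together with its complement, hence the
    bottom. *)
Lemma ultra_lfilter_principal W (w : W) : ultra_lfilter [set a : set W | a w].
Proof.
split=> [|F [[_ FI _] Fbot] wF].
  by split=> //; split=> // a b /subsetPset ab /ab.
apply/seteqP; split=> // a Fa; apply: contrapT => naw; apply: Fbot.
have -> : \bot%O = (a `&` ~` a)%O :> set W by rewrite meetxC.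
by apply: FI Fa _; apply: wF.
Qed.

(** Reflexivity of [RK] puts knowledge inside each ultrafilter, and the inclusion of [RB] in [RK]
    puts it inside belief. *)
Definition kripke_model (W : Type) (w0 : W) (RB RK : W -> W -> Prop)
    (serialB : forall w, exists v, RB w v) (reflK : forall w, RK w w)
    (subBK : forall w v, RB w v -> RK w v) : model.
Proof.
refine (@Model _ (set W) [set a | a w0]
  (fun a => if a == \top%O then \top%O else \bot%O) (nec RB) (nec RK)
  (ultra_lfilter_principal w0) (fun=> erefl) _ _ _) => U [Up _].
- by apply: proper_lfilter_nec Up => w; exists w.
- exact: proper_lfilter_nec.
- have [[_ _ UU] _] := Up; move=> a /= Ua; split; apply: UU Ua.
    by apply/subsetPset => w; apply.
  by apply/subsetPset => w Ka v /subBK; apply: Ka.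
Defined.

(** * The canonical model *)

Record world (G : set form) : Type := World {
  world_set :> form -> Prop;
  world_maximal : maximal_theory world_set;
  world_box : forall f, G (Box f) -> world_set f
}.

Definition canonical_rel (G : set form) (O : form -> form) (w v : world G) :=
  forall f, w (O f) -> v f.

Lemma world_box_iff G (w : world G) f : maximal_theory G ->
  w (Box f) <-> G (Box f).
Proof.
move=> [thG negG]; split=> [wBf|GBf].
  apply: contrapT => /negG GNBf; have [_ negw] := world_maximal w.
  apply/negw : wBf; apply: world_box.
  by apply: theory_thm_mp GNBf => //; apply/thm_ax/ax_box5.
by apply/world_box/(theory_thm_mp thG _ GBf)/thm_ax/ax_box4.
Qed.

Lemma world_omitting G X f : theory X -> (forall h, G (Box h) -> X h) ->
  ~ X f -> exists v : world G, X `<=` world_set v /\ ~ v f.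
Proof.
move=> thX GX /(lindenbaum thX)[T [maxT XT nTf]].
by exists (World maxT (fun h GBh => XT h (GX h GBh))).
Qed.

(** If [O f] is not in [w], the theory of all [h] with [O h] in [w] omits [f]. It contains every [h]
    boxed in [G], so it extends to a successor world omitting [f]. *)
Lemma canonical_truth G (O : form -> form) (w : world G) f :
    maximal_theory G -> (forall X, theory X -> theory [set h | X (O h)]) ->
    (forall h, thm (Imp (Box h) (O h))) ->
  (forall v, canonical_rel O w v -> v f) <-> w (O f).
Proof.
move=> maxG thO boxO; split=> [all_v|wOf v]; last exact.
apply: contrapT => nwOf; have [thw _] := world_maximal w.
have [|v [wv]] := @world_omitting G _ _ (thO _ thw) _ nwOf.
  by move=> h /(world_box_iff w _ maxG) /(theory_thm_mp thw (boxO h)).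
by apply; apply: all_v.
Qed.

Section CanonicalModel.
Variables (G : set form) (maxG : maximal_theory G).

(** Without successors, [Bel Bot] would hold vacuously at [w], against the consistency axiom for
    belief. *)
Lemma canonical_bel_serial (w : world G) : exists v, canonical_rel Bel w v.
Proof.
have [thw negw] := world_maximal w.
apply: contrapT => noR.
have /negw : w (Neg (Bel Bot)) by apply/thw.1/thm_ax/ax_consB.
apply; apply/(canonical_truth w _ maxG theory_bel thm_box_bel) => v wv.
by case: noR; exists v.
Qed.

Lemma canonical_know_refl (w : world G) : canonical_rel Know w w.
Proof.
have [thw _] := world_maximal w.
by move=> f; apply/(theory_thm_mp thw)/thm_ax/ax_KT.
Qed.

Lemma canonical_bel_know (w v : world G) :
  canonical_rel Bel w v -> canonical_rel Know w v.
Proof.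
have [thw _] := world_maximal w.
by move=> wv f wKf; apply/wv/(theory_thm_mp thw _ wKf)/thm_ax/ax_KB.
Qed.

Lemma root_box f : G (Box f) -> G f.
Proof. exact: (theory_thm_mp maxG.1 (thm_box_elim f)). Qed.

Definition root : world G := World maxG root_box.

Definition canonical_model : model :=
  kripke_model root canonical_bel_serial canonical_know_refl canonical_bel_know.

Definition canonical_assignment (n : nat) : canonical_model :=
  [set w : world G | w (Var n)].

Lemma interp_canonical f :
  interp canonical_assignment f = [set w : world G | w f] :> set (world G).
Proof.
elim: f => [n|f IH|f IHf g IHg|f IH|f IH|f IH] //=.
- rewrite IH; apply/seteqP; split=> w;
    by have [_ negw] := world_maximal w; move/negw.
- rewrite IHf IHg; apply/seteqP; split=> w;
    by move/(maximal_theory_imp f g (world_maximal w)).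
- rewrite IH; case: eqP => [all_f|not_all]; apply/seteqP; split=> // w.
    (* If [Box f] were not in [G], the theory of formulas boxed in [G] would omit [f], and some
       world would too, although [f] holds at all worlds. *)
    move=> _ /=; apply/(world_box_iff w f maxG); apply: contrapT => nGBf.
    have [v [_]] := world_omitting (theory_box maxG.1) (fun _ => id) nGBf.
    by apply; have /= -> := congr1 (fun a : set (world G) => a v) all_f.
  move=> /(world_box_iff w f maxG) GBf; case: not_all.
  by apply/seteqP; split=> // v _; apply: world_box.
- have boxK h := thm_ax (ax_boxK h).
  rewrite IH; apply/seteqP; split=> w;
    by move/(canonical_truth w f maxG theory_know boxK).
- rewrite IH; apply/seteqP; split=> w;
    by move/(canonical_truth w f maxG theory_bel thm_box_bel).
Qed.

Lemma satisfies_canonical f : satisfies canonical_assignment f <-> G f.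
Proof. by rewrite /satisfies interp_canonical. Qed.

End CanonicalModel.

Theorem theorem3p8 (Phi : set form) (phi : form) :
  entails Phi phi -> derives Phi phi.
Proof.
move=> ent; apply: contrapT => /(lindenbaum (theory_derives Phi))[G [maxG PhiG]].
(* [G] contains [Phi], so the canonical model satisfies [Phi], and entailment forces the omitted
   [phi] into [G]. *)
apply; apply/(satisfies_canonical maxG)/ent => psi Phi_psi.
by apply/(satisfies_canonical maxG)/PhiG/derives_hyp.
Qed.
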